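(* Suppose $S\in\mathbb R^{d\times d'}$ has rank $r$. Let $S_{\rm red}$ be a reduced $S$-matrix and $U_{\rm red}$ the reduced flux pattern. Suppose that $S_{\rm red}$ is generic. (1) The number of anomalous signs in the core determinant $\operatorname{cd}(S)$ is at least $$\sum_{|\alpha|,|\beta|=r} m\big(U_{\rm red}(\beta|\alpha)\big)$$ and at most $$\sum_{|\alpha|,|\beta|=r}\Big[t\big(U_{\rm red}(\beta|\alpha)\big)-m\big(U_{\rm red}(\beta|\alpha)\big)\Big],$$ where $\alpha$ runs over sets of $r$ row indices and $\beta$ over sets of $r$ column indices of $S_{\rm red}$. (2) The number of terms of sign $(-1)^{d-1}$ in $\operatorname{cd}(S)$ is at least $$\sum_{S_{\rm red}(\alpha|\beta)\in\mathcal N} m\big(U_{\rm red}(\beta|\alpha)\big)$$ and at most $$\sum_{S_{\rm red}(\alpha|\beta)\in\mathcal N}\Big[t\big(U_{\rm red}(\beta|\alpha)\big)-m\big(U_{\rm red}(\beta|\alpha)\big)\Big],$$ where $\mathcal N$ is the set of all $r\times r$ submatrices of $S_{\rm red}$ that are not sign definite.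
   Context: For a matrix $A$, $A(\alpha|\beta)$ is the submatrix with rows indexed by $\alpha$ and columns indexed by $\beta$. Flux pattern: for a real $d\times d'$ matrix $S$, $U$ is the $d'\times d$ matrix whose $(j,i)$ entry is a free variable $U_{ji}$ if $S_{ij}<0$ and $0$ if $S_{ij}\ge 0$. With $r=\operatorname{rank}(S)$, the core determinant is $\operatorname{cd}(S)=\lim_{t\to 0}\frac{1}{t^{d-r}}\det(SU-tI)$, a polynomial in the variables $U_{ji}$. The number of anomalous signs in $\operatorname{cd}(S)$ is the minimum of the number of its terms with positive sign and the number with negative sign. A column $c$ of $S$ is reversible if $-c$ is also a column of $S$; $-c$ is the reverse of $c$. A reduced $S$-matrix $S_{\rm red}$ is a matrix obtained from $S$ by removing one column out of every pair of columns which are reverses of each other; $S_{\rm red}$ contains no reversible columns. The reduced flux pattern $U_{\rm red}$ is built from the sign pattern of $-S_{\rm red}^T$ by setting to $0$ all entries coming from positive entries in columns nonreversible in $S$. In particular, if all columns of $S$ are reversible, $U_{\rm red}$ is the sign pattern of $-S_{\rm red}^T$; if no column of $S$ is reversible, $S_{\rm red}=S$ and $U_{\rm red}=U$. A sign pattern is a matrix whose entries are $\pm$ free variables (one per position) or $0$; the sign pattern of a real matrix $B$ has a free variable with sign $+$, a free variable with sign $-$, or $0$ where $B$ is positive, negative, zero respectively. For a square sign pattern $A$, $t(A)$ is the number of terms and $m_\pm(A)$ the number of terms of sign $\pm$ in $\det A$ viewed as a polynomial in the free variables, and $m(A)=\min\{m_-(A),m_+(A)\}$. A square sign pattern $A$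 is sign definite if $m_-(A)=0$ or $m_+(A)=0$ or $\det A=0$; a square real matrix is sign definite if its sign pattern is. A real matrix is weakly generic if its rank $r$ is maximal among all matrices with the same sign pattern; it is generic if in addition all its $r\times r$ submatrices are weakly generic.
   Formalization: The formal statement additionally assumes that each nonzero column of S has at most one reverse among the columns (reversible columns are not repeated); with repeated reversible columns the bounds can fail. *)

(* Defs.v *)
From HB Require Import structures.
From mathcomp Require Import all_boot all_order all_algebra.
From mathcomp Require Export -(notations) mpoly.
From mathcomp Require Import all_classical all_reals all_analysis.
Set Implicit Arguments.
Unset Strict Implicit.
Unset Printing Implicit Defensive.
Import Order.TTheory GRing.Theory Num.Theory.
Import numFieldNormedType.Exports.
Local Open Scope classical_set_scope.
Local Open Scope ring_scope.

(* The notations of mpoly clash with those of MathComp-Analysis, hence the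
   prefix forms: [mpoly n R] is the ring of polynomials in [n] variables and
   [mpolyX R (mnm1 k)] is its [k]-th variable. A family of variables indexed by
   the positions of a [p * q] matrix is numbered by [mxvec_index]. *)
Definition posvar (R : realType) (p q : nat) (i : 'I_p) (j : 'I_q) :
  mpoly (p * q) R := mpolyX R (mnm1 (mxvec_index i j)).

Section Terms.
Variables (R : realType) (n : nat).

Definition nterms (P : mpoly n R) : nat := size (msupp P).

Definition nterms_sg (s : R) (P : mpoly n R) : nat :=
  count (fun m => Num.sg (mcoeff m P) == s) (msupp P).

Definition anomalous (P : mpoly n R) : nat :=
  minn (nterms_sg 1 P) (nterms_sg (- 1) P).

End Terms.

(* The [a]-element subsets of ['I_p], and the increasing enumeration of one. *)
Definition subs (p a : nat) : finType := {A : {set 'I_p} | #|A| == a}.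

Definition subs_nth (p a : nat) (A : subs p a) (i : 'I_a) : 'I_p :=
  enum_val (cast_ord (esym (eqP (valP A))) i).

Definition submat (T : Type) (p q a b : nat) (M : 'M[T]_(p, q))
  (alpha : subs p a) (beta : subs q b) : 'M[T]_(a, b) :=
  mxsub (subs_nth alpha) (subs_nth beta) M.

Section SignPattern.
Variable R : realType.

Definition sign_pattern (p q : nat) (B : 'M[R]_(p, q)) :
  'M[mpoly (p * q) R]_(p, q) :=
  \matrix_(i, j) (Num.sg (B i j) *: posvar R i j).

Definition sign_definite (n k : nat) (A : 'M[mpoly n R]_k) : bool :=
  [|| nterms_sg (- 1) (\det A) == 0%N, nterms_sg 1 (\det A) == 0%N
    | \det A == 0].

Definition real_sign_definite (k : nat) (B : 'M[R]_k) : bool :=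
  sign_definite (sign_pattern B).

Definition weakly_generic (p q : nat) (A : 'M[R]_(p, q)) : Prop :=
  forall B : 'M[R]_(p, q),
    sign_pattern B = sign_pattern A -> (\rank B <= \rank A)%N.

Definition generic (p q : nat) (A : 'M[R]_(p, q)) : Prop :=
  weakly_generic A /\
  forall (alpha : subs p (\rank A)) (beta : subs q (\rank A)),
    weakly_generic (submat A alpha beta).

End SignPattern.

Section CoreDeterminant.
Variables (R : realType) (d d' : nat) (S : 'M[R]_(d, d')).

Definition flux_pattern : 'M[mpoly (d' * d) R]_(d', d) :=
  \matrix_(j, i) (if S i j < 0 then posvar R j i else 0).

(* The limit of polynomials is taken coefficient by coefficient;
   [core_det_cvg] and [core_det_unique] below show that it exists and is
   unique. *)
Definition is_core_det (P : mpoly (d' * d) R) : Prop :=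
  forall m : multinom (d' * d),
    mcoeff m (t ^- (d - \rank S) *:
      \det (map_mx (@mpolyC _ R) S *m flux_pattern - (mpolyC _ t)%:M))
    @[t --> 0^'] --> mcoeff m P.

Definition core_det : mpoly (d' * d) R := xget 0 is_core_det.

End CoreDeterminant.

Section Reduction.
Variables (R : realType) (d d' : nat) (S : 'M[R]_(d, d')).

Definition reversible (j : 'I_d') : bool :=
  [exists k, col k S == - col j S].

(* Every column that has a reverse has only one: this is what makes "the
   reverse of c" and "the pairs of columns which are reverses of each other"
   meaningful, and it holds if the columns of [S] are pairwise distinct.
   Columns that are not reversible may be repeated. *)
Definition unique_reverse : Prop :=
  forall j k l : 'I_d', col j S != 0 ->
    col k S = - col j S -> col l S = - col j S -> k = l.

(* [K] is the set of columns that are kept. A zero column is its own reverse;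
   it may be kept or removed. *)
Definition is_reduction (K : {set 'I_d'}) : Prop :=
  (forall j, ~~ reversible j -> j \in K) /\
  (forall j k, col j S != 0 -> col k S = - col j S ->
     (j \in K) (+) (k \in K)).

Definition S_red (K : {set 'I_d'}) : 'M[R]_(d, #|K|) :=
  colsub (fun k : 'I_#|K| => enum_val k) S.

Definition U_red (K : {set 'I_d'}) : 'M[mpoly (#|K| * d) R]_(#|K|, d) :=
  \matrix_(k, i)
    (if (0 < S_red K i k) && ~~ reversible (enum_val k) then 0
     else sign_pattern (- (S_red K)^T) k i).

End Reduction.

Lemma char_poly_mulmxC (A : comNzRingType) (d r : nat)
    (C : 'M[A]_(d, r)) (V : 'M[A]_(r, d)) :
  'X^r * char_poly (C *m V) = 'X^d * char_poly (V *m C).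
Proof.
rewrite /char_poly /char_poly_mx !map_mxM /=.
set c := map_mx polyC C; set v := map_mx polyC V.
pose M := block_mx ('X%:M : 'M[{poly A}]_d) c v 1%:M.
have E1 : \det ('X%:M - c *m v) = \det M.
  have : \det (M *m block_mx 1%:M 0 (- v) 1%:M) = \det M.
    by rewrite det_mulmx det_lblock !det1 !mulr1.
  rewrite mulmx_block !mulmx1 !mul1mx !mulmx0 !add0r mulmxN subrr.
  by rewrite det_ublock det1 mulr1.
have : \det (block_mx 1%:M 0 (- v) ('X%:M : 'M[{poly A}]_r) *m M)
       = 'X^r * \det M.
  by rewrite det_mulmx det_lblock det1 mul1r det_scalar.
rewrite mulmx_block !mul1mx !mul0mx !addr0 mulmx1 mul_mx_scalar scalerN.
rewrite mul_scalar_mx addNr det_ublock det_scalar mulNmx E1 => <-.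
by rewrite addrC.
Qed.

Lemma char_poly_mulmx_ge (A : idomainType) (d r : nat)
    (C : 'M[A]_(d, r)) (V : 'M[A]_(r, d)) : (r <= d)%N ->
  char_poly (C *m V) = 'X^(d - r) * char_poly (V *m C).
Proof.
move=> rd; have := char_poly_mulmxC C V.
rewrite -[in X in _ = X * _](subnK rd) addnC exprD -mulrA.
by apply: mulfI; rewrite monic_neq0 ?monicXn.
Qed.

Lemma det_sub_scalar (A : comNzRingType) (d : nat) (M : 'M[A]_d) (t : A) :
  \det (M - t%:M) = (-1) ^+ d * (char_poly M).[t].
Proof.
have -> : M - t%:M = -1 *: (t%:M - M) by rewrite scaleN1r opprB.
rewrite detZ; congr (_ * _).
rewrite /char_poly -horner_evalE -det_map_mx; congr (\det _).
apply/matrixP => i j; rewrite !mxE /= horner_evalE.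
by rewrite hornerD hornerN hornerMn hornerX hornerC.
Qed.

Lemma is_core_det_exists (R : realType) (d d' : nat) (S : 'M[R]_(d, d')) :
  exists P, is_core_det S P.
Proof.
set f := @mpolyC (d' * d) R.
pose q := char_poly (map_mx f (row_base S) *m flux_pattern S
                      *m map_mx f (col_base S)).
have pE : char_poly (map_mx f S *m flux_pattern S) = 'X^(d - \rank S) * q.
  rewrite -{1}(mulmx_base S) map_mxM -mulmxA.
  by rewrite char_poly_mulmx_ge ?rank_leq_row.
exists ((-1) ^+ d * q`_0) => m.
pose Q : {poly R} := \poly_(i < size q) mcoeff m ((-1) ^+ d * q`_i).
have -> : mcoeff m ((-1) ^+ d * q`_0) = Q.[0].
  rewrite horner_coef0 coef_poly; case: ltnP => // /(nth_default 0) ->.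
  by rewrite mulr0 mcoeff0.
apply: cvg_trans (cvg_within_filter _ (@continuous_horner R Q 0)).
apply: near_eq_cvg; near=> t.
have t0 : t != 0 by near: t; exact: nbhs_dnbhs_neq.
rewrite det_sub_scalar pE hornerM hornerXn -mul_mpolyC mulrCA mulrA /f.
rewrite -[mpolyC _ t ^+ _]rmorphXn -mulrA (mulrA (mpolyC _ _)).
rewrite -[mpolyC _ _ * _]mpolyCM mulVf ?expf_neq0 // mul1r.
rewrite horner_poly horner_coef mulr_sumr raddf_sum /=; apply: eq_bigr => i _.
by rewrite mulrA -[mpolyC _ t ^+ _]rmorphXn [in RHS]mulrC mcoeffCM mulrC.
Unshelve. all: by end_near.
Qed.

Lemma core_det_cvg (R : realType) (d d' : nat) (S : 'M[R]_(d, d')) :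
  is_core_det S (core_det S).
Proof. by case: (is_core_det_exists S) => P SP; apply: (xgetPex 0); exists P. Qed.

Lemma core_det_unique (R : realType) (d d' : nat) (S : 'M[R]_(d, d'))
    (P : mpoly (d' * d) R) : is_core_det S P -> P = core_det S.
Proof.
move=> SP; apply/mpolyP => m.
exact: cvg_unique (SP m) (@core_det_cvg R d d' S m).
Qed.

(* Main.v *)
(** By Cauchy-Binet and multilinearity, [cd(S)] is, up to the sign
    [(-1)^(d+r)], the sum over the [r]-element row sets [alpha] and the maps [f]
    from [alpha] to the columns of [det S(alpha|f) * prod_i U_(f i, i)]. The
    monomial determines [(alpha, f)], so counting terms of [cd(S)] means counting
    such pairs. Replacing each removed column by its reverse matches them with
    the triples of an [alpha], a column set [beta] of the reduced matrix and a
    term of [det U_red(beta|alpha)]; the sign of the core determinant term is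
    [(-1)^(d+r)] times that of [det S_red(alpha|beta)] times that of the reduced
    term. By genericity [det S_red(alpha|beta)] is nonzero as soon as
    [det U_red(beta|alpha)] has a term. Hence each block [(alpha, beta)]
    contributes all its terms, with all their signs either kept or flipped, so
    that between [m] and [t - m] of them have a given sign. If
    [S_red(alpha|beta)] is sign definite, the sign of its determinant is that of
    each of its terms, and all terms of the block get the sign [(-1)^d]. *)

Require Import Defs.
From HB Require Import structures.
From mathcomp Require Import all_boot all_order all_algebra.
From mathcomp Require Import fingroup perm zify.
From mathcomp Require Import -(notations) mpoly.
From mathcomp Require Import all_classical all_reals all_analysis.
Set Implicit Arguments.
Unset Strict Implicit.
Unset Printing Implicit Defensive.
Import Order.TTheory GRing.Theory Num.Theory.
Import numFieldNormedType.Exports.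
Local Open Scope ring_scope.

(** * Subsets, their increasing enumerations, and injective maps *)

Lemma subs_nth_inj (p a : nat) (A : subs p a) : injective (subs_nth A).
Proof. by move=> i j /enum_val_inj /cast_ord_inj. Qed.

Lemma subs_nth_in (p a : nat) (A : subs p a) (i : 'I_a) :
  subs_nth A i \in val A.
Proof. exact: enum_valP. Qed.

Lemma imset_subs_nth (p a : nat) (A : subs p a) :
  [set subs_nth A i | i in 'I_a] = val A.
Proof.
apply/eqP; rewrite eqEcard; apply/andP; split.
  by apply/fintype.subsetP => x /imsetP[i _ ->]; exact: subs_nth_in.
by rewrite card_imset ?card_ord ?(eqP (valP A)) //; exact: subs_nth_inj.
Qed.

Lemma subs_nth_surj (p a : nat) (A : subs p a) (x : 'I_p) :
  x \in val A -> exists i, x = subs_nth A i.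
Proof. by rewrite -imset_subs_nth => /imsetP[i _ ->]; exists i. Qed.

(** A permutation followed by the increasing enumeration of a subset: every injective map factors in
    this way, uniquely, the subset being its image. *)
Definition subs_ffun (p a : nat) (z : subs p a * 'S_a) : {ffun 'I_a -> 'I_p} :=
  [ffun i => subs_nth z.1 (z.2 i)].

Lemma subs_ffun_inj (p a : nat) : injective (@subs_ffun p a).
Proof.
move=> [A s] [B t] /ffunP E.
have AB : A = B.
  apply/val_inj => /=; apply/eqP.
  rewrite eqEcard (eqP (valP A)) (eqP (valP B)) leqnn andbT.
  apply/fintype.subsetP => x /subs_nth_surj[i ->].
  have := E ((s^-1)%g i); rewrite !ffunE /= permKV => ->.
  exact: subs_nth_in.
subst B; congr pair; apply/permP => i.
by have := E i; rewrite !ffunE => /subs_nth_inj.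
Qed.

Lemma subs_ffun_surj (p a : nat) (f : {ffun 'I_a -> 'I_p}) :
  injective f -> exists z, f = subs_ffun z.
Proof.
move=> f_inj.
have cA : #|[set f i | i in 'I_a]| == a by rewrite card_imset ?card_ord.
pose A : subs p a := exist (fun A : {set 'I_p} => #|A| == a) _ cA.
have fA i : f i \in val A by exact: imset_f.
have [s sP] := choice (fun i => subs_nth_surj (fA i)).
have s_inj : injective s by move=> i j E; apply: f_inj; rewrite !sP E.
by exists (A, perm s_inj); apply/ffunP => i; rewrite ffunE /= permE.
Qed.

(** [subs_ffun] is a bijection onto the injective maps, and the other maps contribute only the
    unit. *)
Lemma big_ffun_subs (V : Type) (idx : V) (op : Monoid.com_law idx) (p a : nat)
    (F : {ffun 'I_a -> 'I_p} -> V) :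
  (forall f : {ffun 'I_a -> 'I_p}, ~ injective f -> F f = idx) ->
  \big[op/idx]_f F f =
  \big[op/idx]_(A : subs p a) \big[op/idx]_(s : 'S_a) F (subs_ffun (A, s)).
Proof.
move=> F0; rewrite pair_big /=.
transitivity (\big[op/idx]_(f in [set subs_ffun z | z in {: subs p a * 'S_a}])
                F f).
  rewrite [RHS]big_mkcond; apply: eq_bigr => f _; case: ifP => // /negP fn.
  by apply: F0 => /subs_ffun_surj[z E]; apply: fn; rewrite E; exact: imset_f.
rewrite big_imset => [|z1 z2 _ _]; last exact: subs_ffun_inj.
by apply: eq_bigr => -[].
Qed.

(** * Determinants of products and of submatrices *)

(** Multilinearity: column [i] of the product is a combination of the columns of [B], and [f i] is
    the column picked there. *)
Lemma det_mulmx_ffun (A : comNzRingType) (m n : nat)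
    (B : 'M[A]_(m, n)) (C : 'M[A]_(n, m)) :
  \det (B *m C) =
  \sum_(f : {ffun 'I_m -> 'I_n}) (\prod_i C (f i) i) * \det (colsub f B).
Proof.
rewrite -det_tr; under [RHS]eq_bigr do rewrite -det_tr.
rewrite /determinant.
transitivity (\sum_(s : 'S_m) \sum_(f : {ffun 'I_m -> 'I_n})
   (-1) ^+ s * \prod_i (B (s i) (f i) * C (f i) i)).
  apply: eq_bigr => s _; rewrite -mulr_sumr; congr (_ * _).
  rewrite -(bigA_distr_bigA (fun i j => B (s i) j * C j i)) /=.
  by apply: eq_bigr => i _; rewrite !mxE.
rewrite exchange_big /=; apply: eq_bigr => f _.
rewrite mulr_sumr; apply: eq_bigr => s _.
rewrite big_split /= mulrA [RHS]mulrC; congr (_ * _ * _).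
by apply: eq_bigr => i _; rewrite !mxE.
Qed.

Lemma det_mxsub_noninj (A : comNzRingType) (m n k : nat) (g : 'I_k -> 'I_m)
    (f : 'I_k -> 'I_n) (B : 'M[A]_(m, n)) :
  ~ injective f -> \det (mxsub g f B) = 0.
Proof.
move=> /injectiveP/injectivePn[i [j ij fij]].
rewrite -det_tr; apply: (determinant_alternate ij) => l.
by rewrite !mxE fij.
Qed.

Lemma det_mxsub_perm (A : comNzRingType) (m n k : nat) (g : 'I_k -> 'I_m)
    (f : 'I_k -> 'I_n) (s : 'S_k) (B : 'M[A]_(m, n)) :
  \det (mxsub g (f \o s) B) = (-1) ^+ s * \det (mxsub g f B).
Proof.
have -> : mxsub g (f \o s) B = col_perm s (mxsub g f B).
  by apply/matrixP => i j; rewrite !mxE.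
by rewrite col_permE det_mulmx det_perm odd_permV mulrC.
Qed.

Lemma mxsub_subs_ffun (A : Type) (m n k : nat) (g : 'I_k -> 'I_m)
    (b : subs n k) (s : 'S_k) (B : 'M[A]_(m, n)) :
  mxsub g (subs_ffun (b, s)) B = mxsub g (subs_nth b \o s) B.
Proof. by apply/matrixP => i j; rewrite !mxE ffunE. Qed.

(** In [det_mulmx_ffun] a non-injective map repeats a column and gives 0. The maps with image [a]
    differ by permutations, whose signs assemble the Leibniz formula of the minor of [C]. *)
Lemma Cauchy_Binet (A : comNzRingType) (m n : nat)
    (B : 'M[A]_(m, n)) (C : 'M[A]_(n, m)) :
  \det (B *m C) = \sum_(a : subs n m)
     \det (colsub (subs_nth a) B) * \det (rowsub (subs_nth a) C).
Proof.
rewrite det_mulmx_ffun big_ffun_subs => [|f fn]; last first.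
  by rewrite det_mxsub_noninj ?mulr0.
apply: eq_bigr => a _; rewrite -[\det (rowsub _ _)]det_tr.
rewrite [X in _ = _ * X]/determinant mulr_sumr.
apply: eq_bigr => s _; rewrite mxsub_subs_ffun det_mxsub_perm.
rewrite mulrA mulrC; congr (_ * _); rewrite mulrC; congr (_ * _).
by apply: eq_bigr => i _; rewrite !mxE ffunE.
Qed.

(** * Counting the terms of a polynomial by sign *)

Lemma mcoeff_sumX (R : realType) (n : nat) (I : finType) (c : I -> R)
    (f : I -> multinom n) (i : I) : injective f ->
  mcoeff (f i) (\sum_j c j *: mpolyX R (f j)) = c i.
Proof.
move=> f_inj; rewrite raddf_sum /= (bigD1 i) //= mcoeffZ mcoeffX eqxx mulr1.
rewrite big1 ?addr0 // => j ji; rewrite mcoeffZ mcoeffX.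
by rewrite (inj_eq f_inj) (negbTE ji) mulr0.
Qed.

(** Distinct monomials cannot cancel, so terms correspond to indices. The case [s = 0] is excluded
    because zero coefficients do not show in the support. *)
Lemma nterms_sg_sumX (R : realType) (n : nat) (I : finType) (c : I -> R)
    (f : I -> multinom n) (s : R) : injective f -> s != 0 ->
  nterms_sg s (\sum_j c j *: mpolyX R (f j)) = (\sum_j (Num.sg (c j) == s))%N.
Proof.
move=> f_inj s0; set P := \sum_j _; rewrite /nterms_sg -size_filter.
transitivity #|[pred j | Num.sg (c j) == s]|; last first.
  by rewrite -sum1_card big_mkcond; apply: eq_bigr => j _; rewrite inE.
rewrite cardE -(size_map f); apply: perm_size; apply: uniq_perm.
- by rewrite filter_uniq ?msupp_uniq.
- by rewrite map_inj_uniq ?enum_uniq.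
move=> m; rewrite mem_filter mcoeff_msupp.
apply/andP/mapP => [[/eqP sm m0]|[j]]; last first.
  rewrite mem_enum inE => /eqP sj ->; rewrite mcoeff_sumX // sj; split=> //.
  by rewrite -sgr_eq0 sj.
have [[j mj]|nm] := pselect (exists j, m = f j).
  by exists j => //; rewrite mem_enum inE -(mcoeff_sumX c _ f_inj) -mj sm.
case/eqP: m0; rewrite raddf_sum /= big1 // => j _.
rewrite mcoeffZ mcoeffX; case: eqP => [E|]; last by rewrite mulr0.
by case: nm; exists j.
Qed.

Lemma nterms_sg0 (R : realType) (n : nat) (P : mpoly n R) : nterms_sg 0 P = 0%N.
Proof.
apply/eqP; rewrite /nterms_sg -leqn0 leqNgt -has_count.
by apply/hasP => -[m]; rewrite mcoeff_msupp sgr_eq0 => /negbTE ->.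
Qed.

Lemma nterms_sgD (R : realType) (n : nat) (P : mpoly n R) :
  (nterms_sg 1 P + nterms_sg (- 1) P)%N = nterms P.
Proof.
rewrite /nterms_sg /nterms -count_predUI [X in (_ + X)%N](_ : _ = 0)%N ?addn0.
  rewrite -[RHS]count_predT; apply: eq_in_count => m.
  by rewrite mcoeff_msupp /=; case: sgrP; rewrite ?eqxx ?orbT.
rewrite -[RHS](count_pred0 (msupp P)); apply: eq_count => m /=.
by case: eqP => //= ->; rewrite -subr_eq0 opprK -mulr2n pnatr_eq0.
Qed.

Definition mnm_sum (n k : nat) (g : 'I_k -> 'I_n) : multinom n :=
  \big[@mnm_add n/@mnm0 n]_(i < k) mnm1 (g i).

(** The variable [g i] has a positive exponent on the left, hence on the right. This serves to read
    off index data from a monomial. *)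
Lemma mnm_sum_mem (n k : nat) (g h : 'I_k -> 'I_n) (i : 'I_k) :
  mnm_sum g = mnm_sum h -> exists j, g i = h j.
Proof.
move=> /mnmP/(_ (g i)); rewrite !mnm_sumE.
have [[j ghj]|nj] := pselect (exists j, g i = h j); first by exists j.
rewrite (bigD1 i) //= mnm1E eqxx [RHS]big1 // => j _.
by rewrite mnm1E; case: eqP => // E; case: nj; exists j.
Qed.

Lemma det_monomials (R : realType) (n k : nat) (c : 'I_k -> 'I_k -> R)
    (v : 'I_k -> 'I_k -> 'I_n) :
  \det (\matrix_(i, j) (c i j *: mpolyX R (mnm1 (v i j)))) =
  \sum_(s : 'S_k) ((-1) ^+ s * \prod_i c (s i) i) *:
    mpolyX R (mnm_sum (fun i => v (s i) i)).
Proof.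
rewrite -det_tr; apply: eq_bigr => s _.
rewrite -mprodXE -scalerA -scaler_prod -signr_odd.
rewrite scaler_sign -mulr_sign signr_odd; congr (_ * _).
by apply: eq_bigr => i _; rewrite !mxE.
Qed.

(** Since the entries carry pairwise distinct variables, the monomial of a Leibniz term determines
    its permutation. *)
Lemma nterms_sg_det (R : realType) (n k : nat) (c : 'I_k -> 'I_k -> R)
    (v : 'I_k -> 'I_k -> 'I_n) (s : R) :
  (forall i j i' j', v i j = v i' j' -> i = i' /\ j = j') -> s != 0 ->
  nterms_sg s (\det (\matrix_(i, j) (c i j *: mpolyX R (mnm1 (v i j))))) =
  (\sum_(p : 'S_k) (Num.sg ((-1) ^+ p * \prod_i c (p i) i) == s))%N.
Proof.
move=> v_inj s0; rewrite det_monomials nterms_sg_sumX // => p q E.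
apply/permP => i; have [j /v_inj[pq ij]] := mnm_sum_mem i E.
by rewrite pq ij.
Qed.

(** * The core determinant as a sum of monomials *)

(** For [t != 0], dividing the determinant by [t^(d-r)] leaves [(-1)^d q(t)], whose coefficients are
    real polynomials in [t]. The limit is their value at 0. *)
Lemma core_det_char_poly (R : realType) (d d' : nat) (S : 'M[R]_(d, d'))
    (q : {poly mpoly (d' * d) R}) :
  char_poly (map_mx (@mpolyC _ R) S *m flux_pattern S) =
    'X^(d - \rank S) * q ->
  core_det S = (-1) ^+ d * q`_0.
Proof.
move=> qE; apply/esym/core_det_unique => m.
pose Q : {poly R} := \poly_(i < size q) mcoeff m ((-1) ^+ d * q`_i).
have QE t : mcoeff m ((-1) ^+ d * q.[mpolyC _ t]) = Q.[t].
  rewrite horner_poly horner_coef mulr_sumr raddf_sum /=.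
  apply: eq_bigr => i _; rewrite mulrA -[mpolyC _ t ^+ _]rmorphXn.
  by rewrite [in LHS]mulrC mcoeffCM mulrC.
rewrite -[q`_0]horner_coef0 -(raddf0 (@mpolyC (d' * d) R)) QE.
apply: cvg_trans (cvg_within_filter _ (@continuous_horner R Q 0)).
apply: near_eq_cvg; near=> t.
have t0 : t != 0 by near: t; exact: nbhs_dnbhs_neq.
rewrite -QE det_sub_scalar qE hornerM hornerXn mulrCA.
rewrite -[mpolyC _ t ^+ _]rmorphXn.
by rewrite mul_mpolyC scalerA mulVf ?expf_neq0 // scale1r.
Unshelve. all: by end_near.
Qed.

Lemma core_det_minors (R : realType) (d d' : nat) (S : 'M[R]_(d, d')) :
  core_det S = (-1) ^+ (d + \rank S) * \sum_(a : subs d (\rank S))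
    \sum_(f : {ffun 'I_(\rank S) -> 'I_d'})
      (\prod_i flux_pattern S (f i) (subs_nth a i)) *
      mpolyC _ (\det (mxsub (subs_nth a) f S)).
Proof.
set U := flux_pattern S; set r := \rank S; set f := @mpolyC (d' * d) R.
(* The rank factorization of [S] turns the product into [C *m V] with inner size [r]. Swapping the
   factors gives an [r * r] matrix and brings out the power of [X]. *)
pose C := map_mx f (col_base S); pose V := map_mx f (row_base S) *m U.
have SU : map_mx f S *m U = C *m V.
  by rewrite mulmxA -map_mxM mulmx_base.
rewrite (@core_det_char_poly _ _ _ _ (char_poly (V *m C))); last first.
  by rewrite SU char_poly_mulmx_ge ?rank_leq_row.
have -> : (char_poly (V *m C))`_0 = (-1) ^+ r * \det (V *m C).
  have := det_sub_scalar (V *m C) 0.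
  by rewrite raddf0 subr0 horner_coef0 => ->; rewrite signrMK.
rewrite mulrA -exprD Cauchy_Binet; congr (_ * _); apply: eq_bigr => a _.
(* Each Cauchy-Binet summand is recombined into the principal minor of [S U] on the rows [a], from
   which the auxiliary factors have disappeared. *)
rewrite mulrC -det_mulmx -mxsub_mul -SU.
rewrite mxsub_mul det_mulmx_ffun; apply: eq_bigr => g _.
congr (_ * _); first by apply: eq_bigr => i _; rewrite mxE.
rewrite -[RHS]det_map_mx; congr (\det _); apply/matrixP => i j.
by rewrite !mxE.
Qed.

Lemma core_det_monomials (R : realType) (d d' : nat) (S : 'M[R]_(d, d')) :
  core_det S =
  \sum_(z : subs d (\rank S) * {ffun 'I_(\rank S) -> 'I_d'})
    ((-1) ^+ (d + \rank S) * \det (mxsub (subs_nth z.1) z.2 S) *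
       \prod_i (S (subs_nth z.1 i) (z.2 i) < 0)%R%:R) *:
    mpolyX R (mnm_sum (fun i => mxvec_index (z.2 i) (subs_nth z.1 i))).
Proof.
rewrite core_det_minors pair_big /= mulr_sumr; apply: eq_bigr => -[a g] _ /=.
rewrite -mulrA -scalerA -[X in X *: _]signr_odd scaler_sign -mulr_sign signr_odd.
congr (_ * _); rewrite mulrC mul_mpolyC -scalerA; congr (_ *: _).
rewrite -mprodXE -scaler_prod; apply: eq_bigr => i _.
by rewrite mxE; case: ifP => _; rewrite ?scale1r ?scale0r.
Qed.

Lemma mxvec_index_inj (m n : nat) (i i' : 'I_m) (j j' : 'I_n) :
  mxvec_index i j = mxvec_index i' j' -> i = i' /\ j = j'.
Proof. by move=> /cast_ord_inj/enum_rank_inj[-> ->]. Qed.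

(** The rows occurring in a monomial give [a]. As they are distinct, the column paired with each of
    them gives [f], even when [f] is not injective. *)
Lemma nterms_sg_core_det (R : realType) (d d' : nat) (S : 'M[R]_(d, d'))
    (s : R) : s != 0 ->
  nterms_sg s (core_det S) =
  (\sum_(a : subs d (\rank S)) \sum_(f : {ffun 'I_(\rank S) -> 'I_d'} |
      [forall i, S (subs_nth a i) (f i) < 0]%R)
     (Num.sg ((-1) ^+ (d + \rank S) * \det (mxsub (subs_nth a) f S)) == s))%N.
Proof.
move=> s0; rewrite core_det_monomials nterms_sg_sumX //; last first.
  move=> [a f] [b g] /= E.
  have inc i : exists j, f i = g j /\ subs_nth a i = subs_nth b j.
    by have [j /mxvec_index_inj] := mnm_sum_mem i E; exists j.
  have ab : a = b.
    apply/val_inj/eqP; rewrite eqEcard (eqP (valP a)) (eqP (valP b)) leqnn.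
    rewrite andbT; apply/fintype.subsetP => x /subs_nth_surj[i ->] /=.
    by have [j [_ ->]] := inc i; exact: subs_nth_in.
  subst b; congr pair; apply/ffunP => i.
  by have [j [-> /subs_nth_inj->]] := inc i.
rewrite pair_big_dep /= [RHS]big_mkcond; apply: eq_bigr => -[a f] _ /=.
case: ifP => [/forallP neg|/negbT/forallPn[i fi]].
  by rewrite big1 ?mulr1 // => i _; rewrite neg.
by rewrite (bigD1 i) //= (negbTE fi) mul0r mulr0 sgr0 eq_sym (negbTE s0).
Qed.

(** * The reduced flux pattern and the columns it stands for *)

(** The real coefficient of the variable at entry [(k, i)] of [U_red]. *)
Definition red_sign (R : realType) (d d' : nat) (S : 'M[R]_(d, d'))
    (K : {set 'I_d'}) (k : 'I_#|K|) (i : 'I_d) : R :=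
  if (0 < S_red S K i k) && ~~ reversible S (enum_val k) then 0
  else Num.sg (- S_red S K i k).

(* The column of [S] whose flux variables stand for the entry [(k, i)] of the
   reduced flux pattern: the kept column [k] if its entry in row [i] is
   negative, and otherwise its reverse. *)
Definition flux_column (R : realType) (d d' : nat) (S : 'M[R]_(d, d'))
    (K : {set 'I_d'}) (k : 'I_#|K|) (i : 'I_d) : 'I_d' :=
  if S i (enum_val k) < 0 then enum_val k
  else odflt (enum_val k) [pick l | col l S == - col (enum_val k) S].

Lemma flux_column_neg (R : realType) (d d' : nat) (S : 'M[R]_(d, d'))
    (K : {set 'I_d'}) (k : 'I_#|K|) (i : 'I_d) :
  S i (enum_val k) < 0 -> flux_column S k i = enum_val k.
Proof. by rewrite /flux_column => ->. Qed.

Lemma flux_column_pos (R : realType) (d d' : nat) (S : 'M[R]_(d, d'))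
    (K : {set 'I_d'}) (k : 'I_#|K|) (i : 'I_d) :
  0 < S i (enum_val k) -> reversible S (enum_val k) ->
  col (flux_column S k i) S = - col (enum_val k) S.
Proof.
rewrite /flux_column => Sp /existsP[l lE]; rewrite ltNge ltW //=.
by case: pickP => [l' /eqP//|/(_ l)]; rewrite lE.
Qed.

(** The zero case records no hypothesis: its uses all assume a nonzero [red_sign]. *)
Variant red_sign_spec (R : realType) (d d' : nat) (S : 'M[R]_(d, d'))
    (K : {set 'I_d'}) (k : 'I_#|K|) (i : 'I_d) : R -> Prop :=
  | RedSignNeg of S i (enum_val k) < 0 : red_sign_spec S k i 1
  | RedSignPos of 0 < S i (enum_val k) & reversible S (enum_val k) :
      red_sign_spec S k i (- 1)
  | RedSign0 : red_sign_spec S k i 0.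

Lemma red_signP (R : realType) (d d' : nat) (S : 'M[R]_(d, d'))
    (K : {set 'I_d'}) (k : 'I_#|K|) (i : 'I_d) :
  red_sign_spec S k i (red_sign S k i).
Proof.
rewrite /red_sign mxE sgrN; case: ifP => [_|]; first exact: RedSign0.
case: sgrP => [_ _|Sp|Sn _]; first by rewrite oppr0; exact: RedSign0.
  by move=> /negbFE; exact: RedSignPos.
by rewrite opprK; exact: RedSignNeg.
Qed.

Lemma col_neq0 (R : realType) (d d' : nat) (S : 'M[R]_(d, d')) i j :
  S i j != 0 -> col j S != 0.
Proof.
by apply: contraNneq => /matrixP/(_ i ord0); rewrite !mxE => ->.
Qed.

(** Passing from a kept column to its reverse multiplies it by -1, which is [red_sign] in that case;
    the choice makes the entry in row [i] negative. *)
Lemma flux_columnP (R : realType) (d d' : nat) (S : 'M[R]_(d, d'))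
    (K : {set 'I_d'}) (k : 'I_#|K|) (i : 'I_d) : red_sign S k i != 0 ->
  S i (flux_column S k i) < 0 /\
  forall i', S i' (flux_column S k i) = red_sign S k i * S_red S K i' k.
Proof.
case: red_signP => [Sn|Sp rev|/eqP//] _.
  by rewrite flux_column_neg //; split=> // i'; rewrite mxE mul1r.
have /matrixP E := flux_column_pos Sp rev.
have {}E i' : S i' (flux_column S k i) = - S i' (enum_val k).
  by have := E i' ord0; rewrite !mxE.
by rewrite E oppr_lt0; split=> // i'; rewrite E mxE mulN1r.
Qed.

Section FluxColumn.
Variables (R : realType) (d d' : nat) (S : 'M[R]_(d, d')) (K : {set 'I_d'}).
Hypotheses (uniq_S : unique_reverse S) (K_red : is_reduction S K).

(** If one side is a kept column and the other a reverse, two opposite columns are both kept,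
    against [K_red]. If both are reverses, one column has two reverses, against [uniq_S]. *)
Lemma flux_column_inj (k k' : 'I_#|K|) (i : 'I_d) :
  red_sign S k i != 0 -> red_sign S k' i != 0 ->
  flux_column S k i = flux_column S k' i -> k = k'.
Proof.
have mixed (l l' : 'I_#|K|) : S i (enum_val l) < 0 -> 0 < S i (enum_val l') ->
    reversible S (enum_val l') -> flux_column S l i <> flux_column S l' i.
  move=> Sn Sp rev E; have := flux_column_pos Sp rev.
  rewrite -E flux_column_neg // => cE.
  have := K_red.2 _ _ (col_neq0 (lt0r_neq0 Sp)) cE.
  by rewrite !enum_valP.
case: red_signP => [Sn|Sp rev|/eqP//] _;
  case: red_signP => [Sn'|Sp' rev'|/eqP//] _.
- by rewrite !flux_column_neg // => /enum_val_inj.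
- by move=> /mixed; case.
- by move=> /esym /mixed; case.
move=> E; have c := flux_column_pos Sp rev; have c' := flux_column_pos Sp' rev'.
apply: enum_val_inj; apply: (uniq_S (j := flux_column S k i)).
- by rewrite c oppr_eq0 (col_neq0 (lt0r_neq0 Sp)).
- by rewrite c opprK.
- by rewrite E c' opprK.
Qed.

(** A kept [j] represents itself. A removed [j] is reversible with its reverse [l] kept; the entry
    of [l] in row [i] is positive, so its flux column is a reverse of [l], hence [j]. *)
Lemma flux_column_surj (i : 'I_d) (j : 'I_d') : S i j < 0 ->
  exists k : 'I_#|K|, red_sign S k i != 0 /\ flux_column S k i = j.
Proof.
move=> Sn; have cj : col j S != 0 by apply: (col_neq0 (i := i)); rewrite lt_eqF.
have [jK|jK] := boolP (j \in K).
  exists (enum_rank_in jK j).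
  rewrite flux_column_neg ?enum_rankK_in //; split=> //.
  by rewrite /red_sign mxE enum_rankK_in // ltNge ltW //= sgr_eq0 oppr_eq0 lt_eqF.
have /existsP[l /eqP lE] : reversible S j.
  by apply: contraNT jK; exact: K_red.1.
have lK : l \in K by have := K_red.2 _ _ cj lE; rewrite (negbTE jK).
have El := enum_rankK_in lK lK.
have Sl : 0 < S i l.
  by move/matrixP: lE => /(_ i ord0); rewrite !mxE => ->; rewrite oppr_gt0.
have rev : reversible S l by apply/existsP; exists j; rewrite lE opprK.
exists (enum_rank_in lK l); split.
  by rewrite /red_sign mxE El Sl rev /= sgr_eq0 oppr_eq0 gt_eqF.
apply: (uniq_S (j := l)); last by rewrite lE opprK.
  by rewrite lE oppr_eq0.
by rewrite flux_column_pos El.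
Qed.

(** In each row [flux_column] is a bijection from the nonzero entries of [U_red] to the negative
    entries of [S]; apply it pointwise. *)
Lemma sum_flux_column (k : nat) (a : 'I_k -> 'I_d)
    (F : {ffun 'I_k -> 'I_d'} -> nat) :
  (\sum_(f : {ffun 'I_k -> 'I_d'} | [forall i, S (a i) (f i) < 0]%R) F f =
   \sum_(g : {ffun 'I_k -> 'I_#|K|} | [forall i, red_sign S (g i) (a i) != 0]%R)
      F [ffun i => flux_column S (g i) (a i)])%N.
Proof.
pose h (g : {ffun 'I_k -> 'I_#|K|}) := [ffun i => flux_column S (g i) (a i)].
pose G := [set g : {ffun 'I_k -> 'I_#|K|} |
            [forall i, red_sign S (g i) (a i) != 0]].
transitivity (\sum_(f in [set h g | g in G]) F f)%N.
  apply: eq_bigl => f; apply/forallP/imsetP => [neg|[g]].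
    have [g gP] := choice (fun i => flux_column_surj (neg i)).
    exists (finfun g).
      by rewrite inE; apply/forallP => i; rewrite ffunE; case: (gP i).
    by apply/ffunP => i; rewrite !ffunE; case: (gP i).
  rewrite inE => /forallP g0 -> i; rewrite ffunE.
  by case: (flux_columnP (g0 i)).
rewrite big_imset; first by apply: eq_bigl => g; rewrite inE.
move=> g g'; rewrite !inE => /forallP g0 /forallP g0' /ffunP E.
apply/ffunP => i; have := E i; rewrite !ffunE.
exact: flux_column_inj.
Qed.

End FluxColumn.

Lemma det_flux_column (R : realType) (d d' : nat) (S : 'M[R]_(d, d'))
    (K : {set 'I_d'}) (k : nat) (a : 'I_k -> 'I_d) (g : 'I_k -> 'I_#|K|) :
  (forall i, red_sign S (g i) (a i) != 0) ->
  \det (mxsub a [ffun i => flux_column S (g i) (a i)] S) =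
  (\prod_i red_sign S (g i) (a i)) * \det (mxsub a g (S_red S K)).
Proof.
move=> g0.
have -> : mxsub a [ffun i => flux_column S (g i) (a i)] S =
    mxsub a g (S_red S K) *m diag_mx (\row_i red_sign S (g i) (a i)).
  apply/matrixP => i j; rewrite mul_mx_diag !mxE ffunE mulrC.
  by rewrite (flux_columnP (g0 j)).2 mxE.
rewrite det_mulmx det_diag mulrC; congr (_ * _).
by apply: eq_bigr => i _; rewrite mxE.
Qed.

(** * Weak genericity and sign definiteness of square matrices *)

Lemma exists_pos_nonroot (R : realType) (P : {poly R}) :
  P != 0 -> exists2 x : R, 0 < x & P.[x] != 0.
Proof.
(* The candidates 1, ..., [size P] are positive and outnumber the possible roots. *)
move=> P0; pose rs : seq R := [seq k.+1%:R | k <- iota 0 (size P)].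
have : ~~ all (root P) rs.
  apply/negP => all_rs; have := max_poly_roots P0 all_rs.
  rewrite size_map size_iota ltnn map_inj_uniq ?iota_uniq => [/(_ isT)//|i j].
  by move=> /eqP; rewrite eqr_nat => /eqP[].
by case/allPn => _ /mapP[k _ ->] nr; exists k.+1%:R.
Qed.

Lemma det_neq0_rank (R : realType) (k : nat) (A : 'M[R]_k) :
  \det A != 0 -> \rank A = k.
Proof. by move=> A0; rewrite mxrank_unit // unitmxE unitfE. Qed.

(* The entries off the graph of [p] are scaled by a common [x > 0], which keeps
   the sign pattern; the determinant becomes a polynomial in [x] whose constant
   term is the signed product along [p]. *)
Lemma weakly_generic_det (R : realType) (k : nat) (A : 'M[R]_k) (p : 'S_k) :
  weakly_generic A -> \prod_i A i (p i) != 0 -> \det A != 0.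
Proof.
move=> genA Ap; pose N (x : R) : 'M[R]_k :=
  \matrix_(i, j) (A i j * (if j == p i then 1 else x)).
pose M : 'M[{poly R}]_k :=
  \matrix_(i, j) ((A i j)%:P * (if j == p i then 1 else 'X)).
have MN x : (\det M).[x] = \det (N x).
  rewrite -horner_evalE -det_map_mx; congr (\det _); apply/matrixP => i j.
  rewrite !mxE /= horner_evalE hornerM hornerC.
  by case: ifP => _; rewrite ?hornerX ?hornerC.
have N0 : \det (N 0) != 0.
  have -> : N 0 = diag_mx (\row_i A i (p i)) *m perm_mx p.
    apply/matrixP => i j; rewrite mul_diag_mx !mxE [j == _]eq_sym.
    by case: eqP => [->|_]; rewrite ?mulr1 ?mulr0.
  rewrite det_mulmx det_diag det_perm mulf_neq0 ?signr_eq0 //.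
  by under eq_bigr do rewrite mxE.
have [|x x0 Nx] := @exists_pos_nonroot R (\det M).
  by apply: contraNneq N0 => M0; rewrite -MN M0 horner0.
have NA : sign_pattern (N x) = sign_pattern A.
  apply/matrixP => i j; rewrite !mxE; congr (_ *: _).
  by case: ifP => _; rewrite ?mulr1 // sgrM (gtr0_sg x0) mulr1.
have := genA _ NA; rewrite det_neq0_rank ?MN // -?MN // => kA.
by rewrite -unitfE -unitmxE -row_free_unit /row_free eqn_leq rank_leq_row.
Qed.

Lemma sgr_prod (R : realType) (k : nat) (F : 'I_k -> R) :
  Num.sg (\prod_i F i) = \prod_i Num.sg (F i).
Proof. by apply: (big_morph Num.sg) => [x y|]; rewrite ?sgrM ?sgr1. Qed.

Lemma sgr_signM (R : realType) (n : nat) (x : R) :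
  Num.sg ((-1) ^+ n * x) = (-1) ^+ n * Num.sg x.
Proof. by rewrite sgrM sgrX sgrN sgr1. Qed.

Lemma sgr_sign_prod (R : realType) (k n : nat) (F : 'I_k -> R) :
  Num.sg ((-1) ^+ n * \prod_i Num.sg (F i)) = Num.sg ((-1) ^+ n * \prod_i F i).
Proof. by rewrite -sgr_prod !sgr_signM sgr_id. Qed.

Lemma real_sign_definite_terms (R : realType) (k : nat) (B : 'M[R]_k) :
  real_sign_definite B ->
  (forall p : 'S_k, 0 <= (-1) ^+ p * \prod_i B (p i) i) \/
  (forall p : 'S_k, (-1) ^+ p * \prod_i B (p i) i <= 0).
Proof.
have count0 s : s != 0 -> nterms_sg s (\det (sign_pattern B)) = 0%N ->
    forall p : 'S_k, Num.sg ((-1) ^+ p * \prod_i B (p i) i) != s.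
  move=> s0; rewrite nterms_sg_det // => [/eqP|i j i' j' /mxvec_index_inj//].
  rewrite sum_nat_eq0 => /forallP all0 p.
  by have := all0 p; rewrite eqb0 sgr_sign_prod.
have neg0 : nterms_sg (- 1) (\det (sign_pattern B)) = 0%N ->
    forall p : 'S_k, 0 <= (-1) ^+ p * \prod_i B (p i) i.
  move=> /count0 n1 p; have := n1 _ p; rewrite oppr_eq0 oner_eq0 => /(_ isT).
  by apply: contraR; rewrite -ltNge => /ltr0_sg ->.
case/or3P => [/eqP/neg0|/eqP/count0 p1|/eqP D0].
- by left.
- right=> p; have := p1 _ p; rewrite oner_eq0 => /(_ isT).
  by apply: contraR; rewrite -ltNge => /gtr0_sg ->.
(* A zero determinant has no terms at all, in particular no negative one. *)
- by left; apply: neg0; rewrite D0 /nterms_sg msupp0.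
Qed.

(** All Leibniz terms lie weakly on one side of 0, so a nonzero term and a nonzero sum have the same
    sign. *)
Lemma real_sign_definite_sg (R : realType) (k : nat) (B : 'M[R]_k) (p : 'S_k) :
  real_sign_definite B -> \prod_i B i (p i) != 0 ->
  \det B != 0 -> Num.sg ((-1) ^+ p * \prod_i B i (p i)) = Num.sg (\det B).
Proof.
move=> def Bp D0.
(* The inverse permutation puts the product in the form [B (q i) i] of
   [real_sign_definite_terms]. *)
have -> : (-1) ^+ p * \prod_i B i (p i) =
    (-1) ^+ (p^-1)%g * \prod_i B ((p^-1)%g i) i.
  rewrite odd_permV; congr (_ * _); rewrite [RHS](reindex_inj (@perm_inj _ p)).
  by apply: eq_bigr => i _; rewrite permK.
have : (-1) ^+ (p^-1)%g * \prod_i B ((p^-1)%g i) i != 0.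
  rewrite mulf_neq0 ?signr_eq0 //; apply: contraNneq Bp => B0.
  rewrite -[X in _ == X]B0; apply/eqP.
  rewrite [RHS](reindex_inj (@perm_inj _ p)).
  by apply: eq_bigr => i _; rewrite permK.
have DE : \det B = \sum_(q : 'S_k) (-1) ^+ q * \prod_i B (q i) i.
  rewrite -det_tr; apply: eq_bigr => q _; congr (_ * _).
  by apply: eq_bigr => i _; rewrite mxE.
case: (real_sign_definite_terms def) => sgB t0.
  have D1 : 0 < \det B by rewrite lt_def D0 DE sumr_ge0.
  by rewrite (gtr0_sg D1) gtr0_sg // lt_def t0 sgB.
have D1 : \det B < 0 by rewrite lt_neqAle D0 DE sumr_le0.
by rewrite (ltr0_sg D1) ltr0_sg // lt_neqAle t0 sgB.
Qed.

(** * Rank and terms of the reduced matrices *)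

(** A removed column is zero or the negative of a kept one, so the column space does not change. *)
Lemma rank_S_red (R : realType) (d d' : nat) (S : 'M[R]_(d, d'))
    (K : {set 'I_d'}) : is_reduction S K -> \rank (S_red S K) = \rank S.
Proof.
move=> [K1 K2]; rewrite -[LHS]mxrank_tr -[RHS]mxrank_tr.
have -> : (S_red S K)^T = rowsub (fun k : 'I_#|K| => enum_val k) S^T.
  by apply/matrixP => i j; rewrite !mxE.
apply/eqP; rewrite eqn_leq !mxrankS ?rowsub_sub //.
have inK j : j \in K -> (row j S^T <= rowsub (enum_val (A := K)) S^T)%MS.
  by move=> jK; rewrite -(enum_rankK_in jK jK) -row_rowsub row_sub.
apply/row_subP => j; have [/inK//|jK] := boolP (j \in K).
have [cj|cj] := eqVneq (col j S) 0; first by rewrite -tr_col cj trmx0 sub0mx.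
have /existsP[l /eqP lE] : reversible S j.
  by apply: contraNT jK; exact: K1.
have lK : l \in K by have := K2 _ _ cj lE; rewrite (negbTE jK).
have -> : row j S^T = - row l S^T.
  by rewrite -!tr_col lE linearN opprK.
by rewrite eqmx_opp inK.
Qed.

(** Replaces the rank by a variable [r], so that no cast between subset types is needed. *)
Lemma generic_submat (R : realType) (p q r : nat) (A : 'M[R]_(p, q)) :
  generic A -> \rank A = r ->
  forall (a : subs p r) (b : subs q r), weakly_generic (submat A a b).
Proof. by move=> [_ genA] <-. Qed.

Lemma nterms_sg_U_red (R : realType) (d d' r : nat) (S : 'M[R]_(d, d'))
    (K : {set 'I_d'}) (a : subs d r) (b : subs #|K| r) (s : R) : s != 0 ->
  nterms_sg s (\det (submat (U_red S K) b a)) =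
  (\sum_(p : 'S_r) (Num.sg ((-1) ^+ p *
     \prod_i red_sign S (subs_nth b (p i)) (subs_nth a i)) == s))%N.
Proof.
have -> : submat (U_red S K) b a = \matrix_(i, j)
    (red_sign S (subs_nth b i) (subs_nth a j) *:
       mpolyX R (mnm1 (mxvec_index (subs_nth b i) (subs_nth a j)))).
  apply/matrixP => i j; rewrite !mxE /red_sign !mxE.
  by case: ifP; rewrite ?scale0r.
move=> s0; rewrite nterms_sg_det // => i j i' j' /mxvec_index_inj.
by case=> /subs_nth_inj -> /subs_nth_inj ->.
Qed.

Lemma red_sign_neq0 (R : realType) (d d' : nat) (S : 'M[R]_(d, d'))
    (K : {set 'I_d'}) (k : 'I_#|K|) (i : 'I_d) : red_sign S k i != 0 ->
  red_sign S k i = - Num.sg (S_red S K i k) /\ S_red S K i k != 0.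
Proof.
rewrite /red_sign; case: ifP => _; first by rewrite eqxx.
by rewrite sgrN oppr_eq0 sgr_eq0.
Qed.

(** * Counting the core determinant block by block *)

Section CoreDeterminantTerms.
Variables (R : realType) (d d' r : nat) (S : 'M[R]_(d, d')) (K : {set 'I_d'}).
Hypotheses (rank_S : \rank S = r) (uniq_S : unique_reverse S).
Hypotheses (K_red : is_reduction S K) (gen_S : generic (S_red S K)).

Let block (a : subs d r) (b : subs #|K| r) := \det (submat (U_red S K) b a).
Let minor (a : subs d r) (b : subs #|K| r) := \det (submat (S_red S K) a b).

(** Here genericity enters: a term of the block gives a nonzero product along [p] in the submatrix
    of [S_red]. *)
Lemma minor_neq0 a b (p : 'S_r) :
  \prod_i red_sign S (subs_nth b (p i)) (subs_nth a i) != 0 -> minor a b != 0.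
Proof.
move=> up; apply: (@weakly_generic_det _ _ _ p).
  by apply: (generic_submat gen_S); rewrite rank_S_red.
apply/prodf_neq0 => i _; rewrite mxE.
by move/prodf_neq0/(_ i isT)/red_sign_neq0: up => [].
Qed.

Lemma nterms_sg_block_eq0 a b s : minor a b = 0 -> nterms_sg s (block a b) = 0%N.
Proof.
move=> D0; have [->|s0] := eqVneq s 0; first exact: nterms_sg0.
rewrite nterms_sg_U_red // big1 // => p _.
have -> : \prod_i red_sign S (subs_nth b (p i)) (subs_nth a i) = 0.
  by apply/eqP; apply: contraT => /minor_neq0; rewrite D0 eqxx.
by rewrite mulr0 sgr0 eq_sym (negbTE s0).
Qed.

(** The core term of [(b, p)] has the sign of the block term of [p] times [(-1)^(d+r)] times the
    sign of the minor, a factor common to the whole block. *)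
Lemma nterms_sg_core_det_red (s : R) : s != 0 ->
  nterms_sg s (core_det S) = (\sum_(a : subs d r) \sum_(b : subs #|K| r)
     nterms_sg (s * ((-1) ^+ (d + r) * Num.sg (minor a b))) (block a b))%N.
Proof.
move=> s0; rewrite nterms_sg_core_det // rank_S.
apply: eq_bigr => a _; rewrite (sum_flux_column uniq_S K_red) big_mkcond /=.
rewrite (@big_ffun_subs _ _ addn) => [|g g_ninj]; last first.
  case: ifP => // /forallP g0; rewrite det_flux_column //.
  by rewrite det_mxsub_noninj // !mulr0 sgr0 eq_sym (negbTE s0).
apply: eq_bigr => b _; set k := _ * Num.sg _.
have [D0|D0] := eqVneq (minor a b) 0.
  rewrite nterms_sg_block_eq0 // big1 // => p _.
  case: ifP => // /forallP g0; rewrite det_flux_column // mxsub_subs_ffun.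
  rewrite det_mxsub_perm -[mxsub _ _ _]/(submat (S_red S K) a b).
  by rewrite -/(minor a b) D0 !mulr0 sgr0 eq_sym (negbTE s0).
(* As [k] is its own inverse, it can be moved to the other side of the sign equation at the end. *)
have kk : k * k = 1.
  rewrite mulrACA -expr2 sqrr_sign -sgrM mul1r.
  by rewrite gtr0_sg // -expr2 exprn_even_gt0.
have k0 : k != 0.
  by apply/eqP => k0; move/eqP: kk; rewrite k0 mul0r eq_sym oner_eq0.
have sk0 : s * k != 0 by exact: mulf_neq0.
rewrite nterms_sg_U_red //; apply: eq_bigr => p _.
have gE i : subs_ffun (b, p) i = subs_nth b (p i) by rewrite ffunE.
case: ifP => [/forallP g0|/negbT/forallPn[i]]; last first.
  rewrite gE negbK => /eqP u0.
  by rewrite (bigD1 i) //= u0 mul0r mulr0 sgr0 eq_sym (negbTE sk0).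
rewrite det_flux_column // mxsub_subs_ffun det_mxsub_perm.
rewrite -[mxsub _ _ _]/(submat (S_red S K) a b) -/(minor a b).
under eq_bigr do rewrite gE.
set u := \prod_i _; set y := (-1) ^+ p.
rewrite [u * _]mulrCA [y * (_ * _)]mulrA mulrCA.
rewrite sgrM [Num.sg ((-1) ^+ (d + r) * _)]sgr_signM -/k; congr nat_of_bool.
by apply/eqP/eqP => [<-|->]; rewrite -mulrA kk mulr1.
Qed.

(** A block term is a product of [r] signs opposite to those of [S_red], so by definiteness its sign
    is [(-1)^r] times that of the minor. The resulting core sign is [(-1)^d], never the opposite
    one. *)
Lemma nterms_sg_definite a b : real_sign_definite (submat (S_red S K) a b) ->
  nterms_sg (- (-1) ^+ d * ((-1) ^+ (d + r) * Num.sg (minor a b))) (block a b)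
  = 0%N.
Proof.
move=> def; have [D0|D0] := eqVneq (minor a b) 0.
  by rewrite nterms_sg_block_eq0.
rewrite nterms_sg_U_red; last first.
  by rewrite !mulf_neq0 ?oppr_eq0 ?signr_eq0 // sgr_eq0.
rewrite big1 // => p _; apply/eqP; rewrite eqb0.
rewrite exprD mulrA mulrA mulNr -expr2 sqrr_sign mulN1r mulNr.
have [E|u0] := eqVneq (\prod_i red_sign S (subs_nth b (p i)) (subs_nth a i)) 0.
  by rewrite E mulr0 sgr0 eq_sym oppr_eq0 mulf_neq0 ?signr_eq0 ?sgr_eq0.
have uE i : red_sign S (subs_nth b (p i)) (subs_nth a i) =
    - Num.sg (submat (S_red S K) a b i (p i)).
  move/prodf_neq0/(_ i isT)/red_sign_neq0: u0 => [->].
  by rewrite [submat _ _ _ _ _]mxE.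
have sp : \prod_i submat (S_red S K) a b i (p i) != 0.
  apply: contraNneq u0 => /eqP; rewrite prodf_seq_eq0 => /hasP[i _ /= /eqP s0].
  by rewrite (bigD1 i) //= uE s0 sgr0 oppr0 mul0r.
under eq_bigr do rewrite uE -mulN1r.
rewrite big_split /= prodr_const card_ord mulrCA sgr_signM sgr_sign_prod.
rewrite real_sign_definite_sg // -/(minor a b).
rewrite -addr_eq0 -mulr2n mulrn_eq0 /=.
by rewrite mulf_neq0 ?signr_eq0 ?sgr_eq0.
Qed.

(** For a nonzero minor the requested sign is 1 or -1, so the count is one of the two whose minimum
    is [m] and maximum [t - m]. For a zero minor the block has no terms. *)
Lemma nterms_sg_block_bounds a b (s : R) : s ^+ 2 = 1 ->
  (anomalous (block a b)
     <= nterms_sg (s * ((-1) ^+ (d + r) * Num.sg (minor a b))) (block a b)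
     <= nterms (block a b) - anomalous (block a b))%N.
Proof.
move=> s1; have [D0|D0] := eqVneq (minor a b) 0.
  by rewrite /anomalous !nterms_sg_block_eq0.
set x := s * _; have : x ^+ 2 == 1.
  by rewrite !exprMn s1 sqrr_sign -sgrX !mul1r gtr0_sg // exprn_even_gt0.
rewrite /anomalous -nterms_sgD sqrf_eq1 => /orP[] /eqP ->.
  by move: (nterms_sg 1 _) (nterms_sg (- 1) _) => m n; lia.
by move: (nterms_sg 1 _) (nterms_sg (- 1) _) => m n; lia.
Qed.

Lemma core_det_bounds (s : R) : s ^+ 2 = 1 ->
  (\sum_(a : subs d r) \sum_(b : subs #|K| r) anomalous (block a b)
     <= nterms_sg s (core_det S)
     <= \sum_(a : subs d r) \sum_(b : subs #|K| r)
          (nterms (block a b) - anomalous (block a b)))%N.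
Proof.
move=> s1; have s0 : s != 0.
  by apply/eqP => s0; move/eqP: s1; rewrite s0 expr0n eq_sym oner_eq0.
rewrite nterms_sg_core_det_red //; apply/andP; split.
  apply: leq_sum => a _; apply: leq_sum => b _.
  by have /andP[] := nterms_sg_block_bounds a b s1.
apply: leq_sum => a _; apply: leq_sum => b _.
by have /andP[] := nterms_sg_block_bounds a b s1.
Qed.

Lemma core_det_indefinite_bounds :
  (\sum_(a : subs d r)
     \sum_(b : subs #|K| r | ~~ real_sign_definite (submat (S_red S K) a b))
       anomalous (block a b)
     <= nterms_sg (- (-1) ^+ d) (core_det S)
     <= \sum_(a : subs d r)
          \sum_(b : subs #|K| r | ~~ real_sign_definite (submat (S_red S K) a b))
            (nterms (block a b) - anomalous (block a b)))%N.
Proof.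
have s1 : (- (-1) ^+ d : R) ^+ 2 = 1 by rewrite sqrrN sqrr_sign.
have -> : nterms_sg (- (-1) ^+ d) (core_det S) = (\sum_(a : subs d r)
    \sum_(b : subs #|K| r | ~~ real_sign_definite (submat (S_red S K) a b))
      nterms_sg (- (-1) ^+ d * ((-1) ^+ (d + r) * Num.sg (minor a b)))
        (block a b))%N.
  rewrite nterms_sg_core_det_red ?oppr_eq0 ?signr_eq0 //.
  apply: eq_bigr => a _; rewrite [RHS]big_mkcond; apply: eq_bigr => b _.
  by case: ifP => // /negbFE /nterms_sg_definite.
apply/andP; split.
  apply: leq_sum => a _; apply: leq_sum => b _.
  by have /andP[] := nterms_sg_block_bounds a b s1.
apply: leq_sum => a _; apply: leq_sum => b _.
by have /andP[] := nterms_sg_block_bounds a b s1.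
Qed.

End CoreDeterminantTerms.

Theorem theorem3p18 (R : realType) (d d' r : nat) (S : 'M[R]_(d, d'))
  (rank_S : \rank S = r) (uniq_S : unique_reverse S)
  (K : {set 'I_d'}) (K_red : is_reduction S K) (gen_S : generic (S_red S K)) :
  [/\ (\sum_(alpha : subs d r) \sum_(beta : subs #|K| r)
          anomalous (\det (submat (U_red S K) beta alpha))
        <= anomalous (core_det S))%N,
      (anomalous (core_det S)
        <= \sum_(alpha : subs d r) \sum_(beta : subs #|K| r)
             (nterms (\det (submat (U_red S K) beta alpha))
              - anomalous (\det (submat (U_red S K) beta alpha))))%N,
      (\sum_(alpha : subs d r)
         \sum_(beta : subs #|K| r |
                 ~~ real_sign_definite (submat (S_red S K) alpha beta))
          anomalous (\det (submat (U_red S K) beta alpha))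
        <= nterms_sg ((-1) ^ (d%:Z - 1)) (core_det S))%N
    & (nterms_sg ((-1) ^ (d%:Z - 1)) (core_det S)
        <= \sum_(alpha : subs d r)
             \sum_(beta : subs #|K| r |
                     ~~ real_sign_definite (submat (S_red S K) alpha beta))
             (nterms (\det (submat (U_red S K) beta alpha))
              - anomalous (\det (submat (U_red S K) beta alpha))))%N].
Proof.
have bounds := core_det_bounds rank_S uniq_S K_red gen_S.
(* The lower bound on the minimum needs both signs; for the upper bound one sign suffices. *)
have /andP[lo1 hi1] := bounds 1 (expr1n _ _).
have /andP[loN hiN] := bounds (- 1) (etrans (sqrrN _) (expr1n _ _)).
(* The exponent is an integer, so that [d = 0] is covered too. *)
have -> : (-1) ^ (d%:Z - 1) = - (-1) ^+ d :> R.
  by rewrite expfzDr ?oppr_eq0 ?oner_eq0 // exprN1 invrN invr1 mulrN1.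
have /andP[] := core_det_indefinite_bounds rank_S uniq_S K_red gen_S.
split=> //; first by rewrite leq_min lo1.
by rewrite geq_min hi1.
Qed.
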